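(* Let $G$ be a finite group, $\mathbb{F}$ a field of characteristic zero and $k\ge1$ an integer. Let $D_{G,k}$ be the generic $G$-crossed product over $\mathbb{F}$ built from algebraically independent indeterminates $x_{g,h}^{(i)}$ ($g,h\in G$, $1\le i\le k$). Let $\mathbb{L}\le\mathbb{F}(x_{g,h}^{(i)})$ be the field extension of $\mathbb{F}$ generated by all elements of the form $$x_{h,hg_1}^{(j_1)}\,x_{hg_1,hg_1g_2}^{(j_2)}\,x_{hg_1g_2,hg_1g_2g_3}^{(j_3)}\cdots x_{hg_1\cdots g_{m-1},\,hg_1\cdots g_m}^{(j_m)},$$ where $m\ge1$, $1\le j_1,\dots,j_m\le k$, $h,g_1,\dots,g_m\in G$ and $g_1\cdots g_m=e$. Then $(D_{G,k})_e\cong\mathbb{L}$ and $Z(D_{G,k})\cong\mathbb{L}^G$, where $G$ acts on $\mathbb{L}$ by the restriction of the $\mathbb{F}$-automorphisms $\sigma(x_{h,g}^{(i)})=x_{\sigma h,\sigma g}^{(i)}$, $\sigma\in G$.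
   Context: Index rows and columns of matrices in $M_{|G|}(\mathbb{F}(x_{h,g}^{(i)}))$ by $G$, with matrix units $E_{g,h}$. For $g\in G$, $1\le i\le k$ put $X_{g,i}=\sum_{h\in G}x^{(i)}_{h,hg}E_{h,hg}$. Let $R_{G,k}$ be the unital $\mathbb{F}$-subalgebra of $M_{|G|}(\mathbb{F}(x_{h,g}^{(i)}))$ generated by all $X_{g,i}$ ($g\in G$, $1\le i\le k$). The generic $G$-crossed product $D_{G,k}$ is $R_{G,k}$ after inverting all its nonzero central elements (which are scalar matrices), so $D_{G,k}\subseteq M_{|G|}(\mathbb{F}(x_{h,g}^{(i)}))$. The matrix algebra carries the $G$-grading (crossed product grading) in which $E_{g,h}$ has degree $g^{-1}h$; $D_{G,k}$ inherits this grading, and $(D_{G,k})_e$ denotes its component of degree $e$, i.e. the diagonal matrices in $D_{G,k}$. $Z(\cdot)$ denotes the center. Isomorphisms are of $\mathbb{F}$-algebras. *)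

(* Defs.v *)
From HB Require Import structures.
From mathcomp Require Import all_boot all_order all_algebra all_fingroup.
From mathcomp Require Import generic_quotient fraction mpoly.
Set Implicit Arguments.
Unset Strict Implicit.
Unset Printing Implicit Defensive.
Import GRing.Theory.
Local Open Scope ring_scope.

(* F-algebras are given by an ambient ring A and a structure map eta : F -> A;
   subalgebras and subfields of A are Prop-valued subsets. *)
Section Algebras.
Variables (F : fieldType) (A : pzRingType) (eta : F -> A).

Definition subalgebra (S : A -> Prop) : Prop :=
  [/\ forall a, S (eta a),
      forall u v, S u -> S v -> S (u + v)
    & forall u v, S u -> S v -> S (u * v)].

Inductive alg_gen (X : A -> Prop) : A -> Prop :=
| AlgConst a : alg_gen X (eta a)
| AlgGen u : X u -> alg_gen X u
| AlgAdd u v : alg_gen X u -> alg_gen X v -> alg_gen X (u + v)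
| AlgMul u v : alg_gen X u -> alg_gen X v -> alg_gen X (u * v).

Definition center_of (S : A -> Prop) (z : A) : Prop :=
  S z /\ forall u, S u -> z * u = u * z.

End Algebras.

Inductive field_gen (F K : fieldType) (eta : F -> K) (X : K -> Prop) :
  K -> Prop :=
| FieldConst a : field_gen eta X (eta a)
| FieldGen u : X u -> field_gen eta X u
| FieldAdd u v : field_gen eta X u -> field_gen eta X v ->
    field_gen eta X (u + v)
| FieldMul u v : field_gen eta X u -> field_gen eta X v ->
    field_gen eta X (u * v)
| FieldInv u : field_gen eta X u -> field_gen eta X u^-1.

(* F-linearity of f follows from its compatibility with the structure maps. *)
Definition alg_isomorphic (F : fieldType) (A B : pzRingType)
    (etaA : F -> A) (etaB : F -> B) (S : A -> Prop) (T : B -> Prop) : Prop :=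
  [/\ subalgebra etaA S, subalgebra etaB T
    & exists f : A -> B,
        [/\ forall a, f (etaA a) = etaB a,
            forall u v, S u -> S v -> f (u + v) = f u + f v,
            forall u v, S u -> S v -> f (u * v) = f u * f v,
            forall u v, S u -> S v -> f u = f v -> u = v
          & forall w, T w <-> exists2 u, S u & f u = w]].

Section GenericCrossedProduct.
Variables (G : finGroupType) (F : fieldType) (k : nat).

(* (i, h, g) indexes the indeterminate x_{h,g}^{(i)}. *)
Definition var : finType := ('I_k * G * G)%type.

Definition polys : idomainType := {mpoly F[#|var|]}.

Definition ratfun : fieldType := {fraction polys}.

Definition ratC (a : F) : ratfun := tofrac (a%:MP : polys).

Definition xvar (v : var) : polys := 'X_(enum_rank v).

Definition x (i : 'I_k) (h g : G) : ratfun := tofrac (xvar (i, h, g)).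

Definition var_act (s : G) (v : var) : var := (v.1.1, s * v.1.2, s * v.2)%g.

Definition poly_act (s : G) (p : polys) : polys :=
  mmap (@mpolyC #|var| F) (fun j => xvar (var_act s (enum_val j))) p.

(* \n_ and \d_ of a chosen representative; act_frac shows that the choice does
   not matter, and act_ratC and act_x that act s is the F-automorphism
   x_{h,g}^{(i)} |-> x_{sh,sg}^{(i)}. *)
Definition act (s : G) (r : ratfun) : ratfun :=
  tofrac (poly_act s (\n_(repr r))) / tofrac (poly_act s (\d_(repr r))).

Notation mat := 'M[ratfun]_#|G|.

Definition matC (a : F) : mat := (ratC a)%:M.

Definition E (g h : G) : mat := delta_mx (enum_rank g) (enum_rank h).

Definition X (g : G) (i : 'I_k) : mat :=
  \sum_(h : G) x i h (h * g)%g *: E h (h * g)%g.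

Definition inR : mat -> Prop :=
  alg_gen matC (fun A => exists g i, A = X g i).

(* By center_inR_scalar below, invmx is only applied to nonzero scalar
   matrices, so these fractions form a ring. *)
Definition inD (A : mat) : Prop :=
  exists z B, [/\ center_of inR z, z != 0, inR B & A = invmx z *m B].

(* E_{h,h'} has degree h^-1 h'. *)
Definition homogeneous (g : G) (A : mat) : Prop :=
  forall h h' : G, (h^-1 * h')%g != g -> A (enum_rank h) (enum_rank h') = 0.

Definition inDe (A : mat) : Prop := inD A /\ homogeneous 1%g A.

Definition inZD : mat -> Prop := center_of inD.

(* For s = [:: (g_1, j_1); ...; (g_m, j_m)] this is
   x_{h,h g_1}^{(j_1)} ... x_{h g_1..g_{m-1}, h g_1..g_m}^{(j_m)}. *)
Fixpoint walk (h : G) (s : seq (G * 'I_k)) : ratfun :=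
  if s is (g, j) :: s' then x j h (h * g)%g * walk (h * g)%g s' else 1.

Definition closed_walk (r : ratfun) : Prop :=
  exists h s,
    [/\ (0 < size s)%N, (\prod_(gj <- s) gj.1)%g = 1%g & r = walk h s].

Definition inL : ratfun -> Prop := field_gen ratC closed_walk.

Definition inLG (r : ratfun) : Prop := inL r /\ forall s, act s r = r.

Fact ratC_zmod : zmod_morphism ratC.
Proof. by move=> a b; rewrite /ratC !raddfB. Qed.
Fact ratC_monoid : monoid_morphism ratC.
Proof. by split=> [|a b]; rewrite /ratC ?rmorph1 ?rmorphM. Qed.
HB.instance Definition _ := GRing.isZmodMorphism.Build F ratfun ratC ratC_zmod.
HB.instance Definition _ :=
  GRing.isMonoidMorphism.Build F ratfun ratC ratC_monoid.

Fact poly_act_zmod s : zmod_morphism (poly_act s).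
Proof. by move=> p q; rewrite /poly_act raddfB. Qed.
Fact poly_act_monoid s : monoid_morphism (poly_act s).
Proof. by split=> [|p q]; rewrite /poly_act ?rmorph1 ?rmorphM. Qed.
HB.instance Definition _ s :=
  GRing.isZmodMorphism.Build polys polys (poly_act s) (poly_act_zmod s).
HB.instance Definition _ s :=
  GRing.isMonoidMorphism.Build polys polys (poly_act s) (poly_act_monoid s).

Lemma poly_act_C s a : poly_act s (a%:MP : polys) = a%:MP.
Proof. by rewrite /poly_act mmapC. Qed.

Lemma poly_act_X s v : poly_act s (xvar v) = xvar (var_act s v).
Proof. by rewrite /poly_act /xvar mmapX mmap1U enum_rankK. Qed.

Lemma polys_rmorph_ext (f g : {rmorphism polys -> polys}) :
  (forall a, f a%:MP = g a%:MP) -> (forall v, f (xvar v) = g (xvar v)) ->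
  f =1 g.
Proof.
move=> fgC fgX; elim/mpolyind => [|c m p _ _ IH].
  by rewrite (rmorph0 f) (rmorph0 g).
rewrite (rmorphD f) (rmorphD g) IH; congr (_ + _).
rewrite -mul_mpolyC (rmorphM f) (rmorphM g) fgC; congr (_ * _).
rewrite mpolyXE_id (rmorph_prod f) (rmorph_prod g); apply: eq_bigr => i _.
have -> : ('X_i : polys) = xvar (enum_val i) by rewrite /xvar enum_valK.
by rewrite (rmorphXn f) (rmorphXn g) fgX.
Qed.

Lemma poly_actM s t p : poly_act s (poly_act t p) = poly_act (s * t)%g p.
Proof.
apply: (polys_rmorph_ext (f := poly_act s \o poly_act t) (g := poly_act (s * t)%g)).
  by move=> a; rewrite /= !poly_act_C.
by move=> v; rewrite /= !poly_act_X /var_act /= !mulgA.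
Qed.

Lemma poly_act1 p : poly_act 1%g p = p.
Proof.
apply: (polys_rmorph_ext (f := poly_act 1%g) (g := idfun)).
  by move=> a; rewrite /= poly_act_C.
by move=> [[i h] g]; rewrite /= poly_act_X /var_act /= !mul1g.
Qed.

Lemma poly_act_eq0 s p : (poly_act s p == 0) = (p == 0).
Proof.
apply/eqP/eqP => [|->]; last exact: rmorph0.
move/(congr1 (poly_act s^-1%g)).
by rewrite poly_actM mulVg poly_act1 rmorph0.
Qed.

Lemma ratfunE (r : ratfun) :
  r = tofrac (\n_(repr r)) / tofrac (\d_(repr r)).
Proof.
apply: (canRL (mulfK _)); first by rewrite tofrac_eq0 denom_ratioP.
rewrite -{1}[r]reprK; unlock FracField.tofrac.
rewrite -[LHS]FracField.pi_mul; apply/eqmodP; rewrite /= /equivf /FracField.mulf.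
by rewrite !numden_Ratio ?mulr1 ?mul1r ?oner_neq0 ?denom_ratioP // mulrC.
Qed.

Lemma act_frac s p q : q != 0 ->
  act s (tofrac p / tofrac q) = tofrac (poly_act s p) / tofrac (poly_act s q).
Proof.
move=> q0; set r := _ / _; have dn0 := denom_ratioP (repr r).
have : tofrac (\n_(repr r)) / tofrac (\d_(repr r)) = tofrac p / tofrac q.
  by rewrite -ratfunE.
move/eqP; rewrite eqr_div ?tofrac_eq0 // -!tofracM tofrac_eq => /eqP e.
apply/eqP; rewrite /act eqr_div ?tofrac_eq0 ?poly_act_eq0 //.
by rewrite -!tofracM tofrac_eq -!rmorphM e.
Qed.

Lemma act_tofrac s p : act s (tofrac p) = tofrac (poly_act s p).
Proof.
by rewrite -[tofrac p]divr1 -(tofrac1 polys) act_frac ?oner_neq0 // !rmorph1 divr1.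
Qed.

Fact act_zmod s : zmod_morphism (act s).
Proof.
move=> u v; rewrite [u]ratfunE [v]ratfunE.
move: (denom_ratioP (repr u)) (denom_ratioP (repr v)).
move: \n_(repr u) \d_(repr u) \n_(repr v) \d_(repr v) => a b c d b0 d0.
rewrite -mulNr addf_div ?tofrac_eq0 // -tofracN -!tofracM -tofracD.
rewrite !act_frac ?mulf_neq0 // -mulNr addf_div ?tofrac_eq0 ?poly_act_eq0 //.
by rewrite -tofracN -!tofracM -tofracD rmorphD !rmorphM rmorphN.
Qed.

Fact act_monoid s : monoid_morphism (act s).
Proof.
split=> [|u v]; first by rewrite -(tofrac1 polys) act_tofrac rmorph1.
rewrite [u]ratfunE [v]ratfunE.
move: (denom_ratioP (repr u)) (denom_ratioP (repr v)).
move: \n_(repr u) \d_(repr u) \n_(repr v) \d_(repr v) => a b c d b0 d0.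
by rewrite mulf_div -!tofracM !act_frac ?mulf_neq0 // mulf_div -!tofracM !rmorphM.
Qed.

HB.instance Definition _ s :=
  GRing.isZmodMorphism.Build ratfun ratfun (act s) (act_zmod s).
HB.instance Definition _ s :=
  GRing.isMonoidMorphism.Build ratfun ratfun (act s) (act_monoid s).

Lemma act_ratC s a : act s (ratC a) = ratC a.
Proof. by rewrite act_tofrac poly_act_C. Qed.

Lemma act_x s i h g : act s (x i h g) = x i (s * h)%g (s * g)%g.
Proof. by rewrite act_tofrac poly_act_X. Qed.

Lemma actM s t r : act s (act t r) = act (s * t)%g r.
Proof. by rewrite [r]ratfunE !act_frac ?poly_act_eq0 ?denom_ratioP // !poly_actM. Qed.

Lemma act1 r : act 1%g r = r.
Proof. by rewrite [RHS]ratfunE {1}[r]ratfunE act_frac ?denom_ratioP // !poly_act1. Qed.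

Lemma act_inL s r : inL r -> inL (act s r).
Proof.
elim=> [a|u|u v _ IHu _ IHv|u v _ IHu _ IHv|u _ IHu].
- by rewrite act_ratC; apply: FieldConst.
- case=> h [p [sz p1 ->]]; apply: FieldGen; exists (s * h)%g, p; split=> //.
  elim: p h {sz p1} => [|[g j] p IH] h /=; first exact: rmorph1.
  by rewrite rmorphM /= act_x IH mulgA.
- by rewrite rmorphD; apply: FieldAdd.
- by rewrite rmorphM; apply: FieldMul.
- by rewrite fmorphV; apply: FieldInv.
Qed.

Lemma x_inj i h g i' h' g' : x i h g = x i' h' g' -> (i, h, g) = (i', h', g').
Proof.
move/eqP; rewrite tofrac_eq => /eqP.
move/(congr1 (mcoeff U_(enum_rank ((i, h, g) : var))%MM)).
rewrite !mcoeffXU eqxx; case: eqP => [/enum_rank_inj -> //|_] /eqP.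
by rewrite oner_eq0.
Qed.

Lemma x_neq0 i h g : x i h g != 0.
Proof.
rewrite tofrac_eq0; apply/eqP.
move/(congr1 (mcoeff U_(enum_rank ((i, h, g) : var))%MM)).
by rewrite mcoeffXU eqxx mcoeff0 => /eqP; rewrite oner_eq0.
Qed.

Lemma X_entry g i h h' :
  X g i (enum_rank h) (enum_rank h') = if h' == (h * g)%g then x i h h' else 0.
Proof.
rewrite /X summxE (bigD1 h) //= big1 => [|h1 /negPf nh].
  rewrite addr0 !mxE eqxx (inj_eq enum_rank_inj) /=.
  by case: eqP => [->|_]; rewrite ?mulr1 ?mulr0.
by rewrite !mxE (inj_eq enum_rank_inj) eq_sym nh mulr0.
Qed.

Lemma mulX_entry g i (z : mat) h h' :
  (X g i *m z) (enum_rank h) (enum_rank h') =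
  x i h (h * g)%g * z (enum_rank (h * g)%g) (enum_rank h').
Proof.
rewrite mxE (bigD1 (enum_rank (h * g)%g)) //= X_entry eqxx big1 ?addr0 // => j.
rewrite -[j]enum_valK (inj_eq enum_rank_inj) X_entry => /negPf ->.
by rewrite mul0r.
Qed.

Lemma Xmul_entry g i (z : mat) h h' :
  (z *m X g i) (enum_rank h) (enum_rank (h' * g)%g) =
  z (enum_rank h) (enum_rank h') * x i h' (h' * g)%g.
Proof.
rewrite mxE (bigD1 (enum_rank h')) //= X_entry eqxx big1 ?addr0 // => j.
rewrite -[j]enum_valK (inj_eq enum_rank_inj) X_entry.
by rewrite (inj_eq (mulIg g)) eq_sym => /negPf ->; rewrite mulr0.
Qed.

Lemma center_inR_scalar (z : mat) :
  (0 < k)%N -> center_of inR z -> exists c, z = c%:M.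
Proof.
move=> k0 [_ zC]; pose i0 := Ordinal k0.
have XR g : inR (X g i0) by apply: AlgGen; exists g, i0.
have cz g h h' : z (enum_rank h) (enum_rank h') * x i0 h' (h' * g)%g =
    x i0 h (h * g)%g * z (enum_rank (h * g)%g) (enum_rank (h' * g)%g).
  by rewrite -Xmul_entry -mulX_entry; congr (fun_of_matrix _ _ _); apply: zC.
have z0 h h' : h != h' -> z (enum_rank h) (enum_rank h') = 0.
  move=> nh; have := cz 1%g h h'; rewrite !mulg1 mulrC => /eqP.
  rewrite -subr_eq0 -mulrBl mulf_eq0 subr_eq0 => /orP[/eqP/x_inj[/eqP]|/eqP//].
  by rewrite eq_sym (negPf nh).
have zd h : z (enum_rank h) (enum_rank h) = z (enum_rank 1%g) (enum_rank 1%g).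
  have := cz h 1%g 1%g; rewrite !mul1g mulrC => /(mulfI _) -> //.
  exact: x_neq0.
exists (z (enum_rank 1%g) (enum_rank 1%g)); apply/matrixP => a b.
rewrite -[a]enum_valK -[b]enum_valK mxE (inj_eq enum_rank_inj).
by case: eqP => [->|/eqP/z0].
Qed.

End GenericCrossedProduct.

(* Main.v *)
(** Every [A] in [D] satisfies [A (s h) (s g) = act s (A h g)], so a diagonal
    one has the form [diag_act r], with [(h, h)] entry [act h r], and is
    determined by its [(1, 1)] entry [r]; it is central exactly when [r] is
    [G]-invariant.  Entries of elements of [R], multiplied by a
    returning edge, lie in [L], so the [(1, 1)] entries [r] lie in [L].
    Conversely, the [b] with [diag_act b] in [R] form a ring generating the
    field [L].  Sandwiching [diag_act b] between [X s] and [X s^-1] replaces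
    [b] by [x 1 s * x s 1 * act s b]; multiplying over [s != 1] gives, after
    replacing [b] by [b * \prod_(s != 1) x 1 s * x s 1], a multiple of [b] in
    that ring which is a norm, hence [G]-invariant.  So [diag_act b] is
    invertible in [D]. *)
Require Import Defs.
From mathcomp Require Import all_boot all_order all_algebra all_fingroup.
From mathcomp Require Import ring.
Import GRing.Theory.
Local Open Scope ring_scope.

(* Gives both factors of [a * b] their returning edges [p] and [q]; [z * y] and
   [y * q * p] are closed walks. *)
Lemma mul_return (Q : fieldType) (a b z p q y : Q) :
  p != 0 -> q != 0 -> y != 0 ->
  a * b * z = (a * p) * (b * q) * ((z * y) / (y * q * p)).
Proof. by move=> p0 q0 y0; field; rewrite p0 q0 y0. Qed.

Section GenericCrossedProduct.
Variables (G : finGroupType) (F : fieldType) (k : nat).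

Local Notation K := (ratfun G F k).
Local Notation mat := 'M[K]_#|G|.
Local Notation x := (@Defs.x G F k).
Local Notation X := (@Defs.X G F k).
Local Notation act := (@Defs.act G F k).
Local Notation inR := (@Defs.inR G F k).
Local Notation inL := (@Defs.inL G F k).
Local Notation inD := (@Defs.inD G F k).
Local Notation walk := (@Defs.walk G F k).
Local Notation ent A h g := (A (@enum_rank G h) (@enum_rank G g)).
Implicit Types (h g s t : G) (i j : 'I_k) (r b c : K) (A B : mat).

(** * Matrix entries indexed by $G$ and the twisted diagonal embedding *)

Lemma mat_ext (A B : mat) : (forall h g, ent A h g = ent B h g) -> A = B.
Proof.
by move=> eqAB; apply/matrixP=> a b; rewrite -[a]enum_valK -[b]enum_valK.
Qed.

Lemma ent_mul (A B : mat) h g :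
  ent (A *m B) h g = \sum_t ent A h t * ent B t g.
Proof.
rewrite mxE (reindex (@enum_rank G)) //=.
by exists enum_val => t _; rewrite ?enum_rankK ?enum_valK.
Qed.

(* Locked, as unification would otherwise unfold the arithmetic of [ratfun]. *)
Definition diag_act : K -> mat :=
  locked (fun r => diag_mx (\row_j act (enum_val j) r)).

Lemma diag_actE r h g : ent (diag_act r) h g = if h == g then act h r else 0.
Proof.
by rewrite /diag_act -lock !mxE enum_rankK (inj_eq enum_rank_inj); case: eqP.
Qed.

Lemma diag_actM r r' : diag_act (r * r') = diag_act r *m diag_act r'.
Proof.
rewrite /diag_act -lock mulmx_diag; congr diag_mx.
by apply/rowP=> j; rewrite !mxE rmorphM.
Qed.

Lemma diag_act_scalar c : (forall s, act s c = c) -> diag_act c = c%:M.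
Proof.
move=> cG; rewrite /diag_act -lock -diag_const_mx; congr diag_mx.
by apply/rowP=> j; rewrite !mxE cG.
Qed.

Lemma diag_act_inj : injective diag_act.
Proof.
move=> r r' /matrixP/(_ (@enum_rank G 1%g) (@enum_rank G 1%g)).
by rewrite !diag_actE eqxx !Defs.act1.
Qed.

Lemma diag_actD r r' : diag_act (r + r') = diag_act r + diag_act r'.
Proof.
apply: mat_ext => h g; rewrite [RHS]mxE !diag_actE.
by case: eqP; rewrite ?rmorphD ?addr0.
Qed.

Lemma matCE a : matC G k a = diag_act (ratC G k a).
Proof. by rewrite diag_act_scalar // => s; apply: act_ratC. Qed.

(** The index shifts by [s] and [s^-1] cancel, so [R] realizes the action of [s] on diagonals up to
    a nonzero factor. *)
Lemma X_diag_act_X i s r :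
  X s i *m diag_act r *m X s^-1%g i =
  diag_act (x i 1%g s * act s r * x i s 1%g).
Proof.
(* Writing [g] as [g * s * s^-1] gives the column the form that [Xmul_entry] expects. *)
apply: mat_ext => h g; rewrite -[in LHS](mulgK s g) Xmul_entry mulX_entry.
rewrite !diag_actE mulgK (inj_eq (mulIg s)).
case: eqP => [->|_]; last by rewrite mulr0 mul0r.
by rewrite 2!rmorphM /= !act_x Defs.actM !mulg1.
Qed.

(** * Walks, products of generators and equivariance of [R] *)

Lemma act_walk s h p : act s (walk h p) = walk (s * h)%g p.
Proof.
elim: p h => [|[g j] p IHp] h /=; first exact: rmorph1.
by rewrite rmorphM /= act_x IHp mulgA.
Qed.

Lemma ent_prod_X p h g :
  ent (\prod_(gj <- p) X gj.1 gj.2) h g =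
  if g == (h * \prod_(gj <- p) gj.1)%g then walk h p else 0.
Proof.
elim: p h => [|[s j] p IHp] h.
  by rewrite !big_nil mulg1 mxE (inj_eq enum_rank_inj) eq_sym; case: eqP.
rewrite !big_cons -mulmxE mulX_entry IHp /= mulgA.
by case: ifP => // _; rewrite mulr0.
Qed.

Lemma inR1 : inR 1.
Proof.
have := AlgConst (matC G k) (fun A => exists g i, A = X g i) 1.
by rewrite /matC rmorph1.
Qed.

Lemma inR_diag_act1 : inR (diag_act 1).
Proof. by rewrite diag_act_scalar => [|s]; [exact: inR1 | exact: rmorph1]. Qed.

Lemma inR_diag_actM r r' :
  inR (diag_act r) -> inR (diag_act r') -> inR (diag_act (r * r')).
Proof. by rewrite diag_actM mulmxE; exact: AlgMul. Qed.

Lemma inR_walk p : (\prod_(gj <- p) gj.1)%g = 1%g -> inR (diag_act (walk 1%g p)).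
Proof.
move=> p1.
have -> : diag_act (walk 1%g p) = \prod_(gj <- p) X gj.1 gj.2.
  apply: mat_ext => h g; rewrite diag_actE ent_prod_X p1 mulg1 eq_sym.
  by rewrite act_walk mulg1.
apply: (big_ind inR) => [||gj _]; first exact: inR1.
  by move=> A B; apply: AlgMul.
by apply: AlgGen; exists gj.1, gj.2.
Qed.

Lemma inR_X_diag_act_X i s r : inR (diag_act r) ->
  inR (diag_act (x i 1%g s * act s r * x i s 1%g)).
Proof.
move=> Rr; rewrite -X_diag_act_X.
by do 2?apply: AlgMul => //; apply: AlgGen; do 2!eexists.
Qed.

(** Left translation permutes the indeterminates and fixes every degree $h^{-1}g$; products inherit
    the symmetry by translating the summation index. *)
Lemma inR_act A s h g : inR A -> ent A (s * h)%g (s * g)%g = act s (ent A h g).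
Proof.
move=> RA; elim: RA h g => [a|_ [t [i ->]]|u v _ IHu _ IHv|u v _ IHu _ IHv] h g.
- rewrite matCE !diag_actE (inj_eq (mulgI s)).
  by case: eqP => _; [rewrite !act_ratC | rewrite rmorph0].
- rewrite !X_entry -mulgA (inj_eq (mulgI s)).
  by case: eqP => _; [rewrite act_x | rewrite rmorph0].
- by rewrite !mxE IHu IHv rmorphD.
rewrite -mulmxE !ent_mul rmorph_sum (reindex_inj (mulgI s)) /=.
by apply: eq_bigr => t _; rewrite IHu IHv rmorphM.
Qed.

Lemma diag_act_ent (A : mat) :
  (forall s h g, ent A (s * h)%g (s * g)%g = act s (ent A h g)) ->
  homogeneous 1%g A -> A = diag_act (ent A 1%g 1%g).
Proof.
move=> Aact A1; apply: mat_ext => h g; rewrite diag_actE.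
case: eqP => [<-|/eqP nhg]; first by rewrite -Aact mulg1.
by apply: A1; rewrite -eq_mulVg1.
Qed.

Lemma homogeneous_diag_act r : homogeneous 1%g (diag_act r).
Proof. by move=> h g; rewrite -eq_mulVg1 diag_actE => /negPf ->. Qed.

(** * Fractions with invariant denominators *)

Definition invariant (c : K) := forall s, act s c = c.

Lemma center_inR_invariant c :
  inR (diag_act c) -> invariant c -> center_of inR (diag_act c).
Proof.
by move=> Rc cG; split=> // u _; rewrite diag_act_scalar // -!mulmxE scalar_mxC.
Qed.

Lemma scalar_invariant c : inR c%:M -> invariant c.
Proof.
move=> Rc s; have := inR_act _ s 1%g 1%g Rc.
by rewrite !mxE !eqxx !mulr1n.
Qed.

(** Central elements of [R] are scalar, and equivariance of entries makes the scalar invariant;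
    denominators thus become field elements instead of inverse matrices. *)
Lemma inDP A : (0 < k)%N ->
  inD A <-> exists c B,
    [/\ inR (diag_act c), invariant c, c != 0, inR B & A = c^-1 *: B].
Proof.
move=> k0; split=> [[z [B [zC z0 RB ->]]]|[c [B [Rc cG c0 RB ->]]]].
  have [c zE] := center_inR_scalar k0 zC; rewrite {}zE in zC z0 *.
  have cG := scalar_invariant _ zC.1.
  exists c, B; split=> //; first by rewrite diag_act_scalar //; case: zC.
    by apply: contraNneq z0 => ->; rewrite raddf0.
  by rewrite invmx_scalar mul_scalar_mx.
exists (diag_act c), B; split=> //; first exact: center_inR_invariant.
  rewrite (_ : 0 = diag_act 0); first by rewrite (inj_eq diag_act_inj).
  by rewrite diag_act_scalar ?raddf0 // => s; rewrite rmorph0.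
by rewrite diag_act_scalar // invmx_scalar mul_scalar_mx.
Qed.

Lemma inD_act A s h g : (0 < k)%N -> inD A ->
  ent A (s * h)%g (s * g)%g = act s (ent A h g).
Proof.
move=> k0 /(inDP _ k0)[c [B [_ cG _ RB ->]]].
by rewrite !mxE inR_act // rmorphM fmorphV /= cG.
Qed.

Lemma inD_inR A : inR A -> inD A.
Proof.
exists 1%:M, A; split=> //; last by rewrite invmx1 mul1mx.
  by split=> [|u _]; [exact: inR1 | rewrite -!mulmxE scalar_mxC].
(* The size [#|G|] is not syntactically a successor, so [1 != 0] comes from injectivity of
   [diag_act]. *)
suff : diag_act 1 != diag_act 0.
  rewrite !diag_act_scalar ?raddf0 // => s; [exact: rmorph0 | exact: rmorph1].
by rewrite (inj_eq diag_act_inj) oner_neq0.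
Qed.

Lemma inD_diag_act r : (0 < k)%N ->
  inD (diag_act r) <-> exists b c, [/\ inR (diag_act b), inR (diag_act c),
    invariant c, c != 0 & r = b / c].
Proof.
move=> k0; rewrite inDP //; split=> [[c [B [Rc cG c0 RB rE]]]|].
  exists (c * r), c; split=> //; last by rewrite mulrC mulKf.
  by rewrite diag_actM rE diag_act_scalar // mul_scalar_mx scalerA divff ?scale1r.
case=> b [c [Rb Rc cG c0 ->]]; exists c, (diag_act b); split=> //.
rewrite mulrC diag_actM diag_act_scalar ?mul_scalar_mx // => s.
by rewrite fmorphV /= cG.
Qed.

(** * Norms and inverses of diagonal elements *)

Lemma inR_norm b : (0 < k)%N -> inR (diag_act b) -> b != 0 ->
  exists c, [/\ inR (diag_act c), c != 0 & invariant (b * c)].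
Proof.
move=> k0 Rb b0; pose i := Ordinal k0.
pose T (r : K) := \prod_(s : G | s != 1%g) (x i 1%g s * act s r * x i s 1%g).
have R_T r : inR (diag_act r) -> inR (diag_act (T r)).
  move=> Rr; apply: (big_ind (fun u => inR (diag_act u))).
  - exact: inR_diag_act1.
  - exact: inR_diag_actM.
  by move=> s _; apply: inR_X_diag_act_X.
have T_neq0 r : r != 0 -> T r != 0.
  move=> r0; apply/prodf_neq0 => s _.
  by apply: mulf_neq0 (x_neq0 F _ _ _); rewrite mulf_neq0 ?fmorph_eq0 ?x_neq0.
have TE r : T r = T 1 * \prod_(s | s != 1%g) act s r.
  rewrite -big_split; apply: eq_bigr => s _ /=.
  by rewrite rmorph1 mulr1 mulrAC.
have R1 : inR (diag_act (T 1)).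
  exact/R_T/inR_diag_act1.
have e0 : T 1 != 0 by apply: T_neq0; apply: oner_neq0.
(* As [T r] is [T 1] times the conjugates of [r] by all [s != 1], the inner [T 1] supplies the
   missing factor: the product with [b] is the full norm of [T 1 * b]. *)
exists (T (T 1 * b)); split.
- exact/R_T/inR_diag_actM.
- exact: T_neq0 (mulf_neq0 e0 b0).
move=> s; have -> : b * T (T 1 * b) = \prod_t act t (T 1 * b).
  by rewrite TE mulrA [RHS](bigD1 1%g) //= Defs.act1 (mulrC b).
rewrite rmorph_prod [RHS](reindex_inj (mulgI s)) /=.
by apply: eq_bigr => t _; rewrite Defs.actM.
Qed.

Lemma inD_diag_actV r : (0 < k)%N ->
  inD (diag_act r) -> inD (diag_act r^-1).
Proof.
(* The inverse of [0] is [0] by convention. *)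
move=> k0; have [->|r0] := eqVneq r 0; first by rewrite invr0.
case/(inD_diag_act _ k0) => b [c [Rb Rc cG c0 rE]].
have b0 : b != 0 by apply: contraNneq r0 => b0; rewrite rE b0 mul0r.
have [d [Rd d0 bdG]] := inR_norm b k0 Rb b0.
(* $(b/c)^{-1} = cd/(bd)$ has an invariant denominator even when [b] is not invariant. *)
apply/(inD_diag_act _ k0); exists (c * d), (b * d); split.
- exact: inR_diag_actM.
- exact: inR_diag_actM.
- exact: bdG.
- exact: mulf_neq0 b0 d0.
by rewrite rE invf_div -mulf_div divff ?mulr1.
Qed.

Lemma inD_diag_actM r r' : (0 < k)%N ->
  inD (diag_act r) -> inD (diag_act r') -> inD (diag_act (r * r')).
Proof.
move=> k0 /(inD_diag_act _ k0)[b [c [Rb Rc cG c0 ->]]].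
case/(inD_diag_act _ k0) => b' [c' [Rb' Rc' cG' c0' ->]].
apply/(inD_diag_act _ k0); exists (b * b'), (c * c'); split.
- exact: inR_diag_actM.
- exact: inR_diag_actM.
- by move=> s; rewrite rmorphM /= cG cG'.
- exact: mulf_neq0 c0 c0'.
by rewrite mulf_div.
Qed.

Lemma inD_diag_actD r r' : (0 < k)%N ->
  inD (diag_act r) -> inD (diag_act r') -> inD (diag_act (r + r')).
Proof.
move=> k0 /(inD_diag_act _ k0)[b [c [Rb Rc cG c0 ->]]].
case/(inD_diag_act _ k0) => b' [c' [Rb' Rc' cG' c0' ->]].
apply/(inD_diag_act _ k0); exists (b * c' + b' * c), (c * c'); split.
- by rewrite diag_actD; apply: AlgAdd; apply: inR_diag_actM.
- exact: inR_diag_actM.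
- by move=> s; rewrite rmorphM /= cG cG'.
- exact: mulf_neq0 c0 c0'.
by rewrite addf_div.
Qed.

Lemma inL_inD r : (0 < k)%N -> inL r -> inD (diag_act r).
Proof.
move=> k0; elim=> {r} [a|_ [h [p [_ p1 ->]]]|u v _ Du _ Dv|u v _ Du _ Dv|u _ Du].
- by rewrite -matCE; apply: inD_inR; apply: AlgConst.
(* Sandwiching moves the base point from [1] to [h] at the cost of the factor [e], itself the
   sandwich of [1] and hence invertible in [D]. *)
- pose i := Ordinal k0; pose e := x i 1%g h * x i h 1%g.
  have e0 : e != 0 := mulf_neq0 (x_neq0 _ _ _ _) (x_neq0 _ _ _ _).
  have -> : walk h p = (x i 1%g h * act h (walk 1%g p) * x i h 1%g) * e^-1.
    by rewrite act_walk mulg1 (mulrAC (x i 1%g h)) (mulrC _ (walk h p)) mulfK.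
  apply: inD_diag_actM => //; first by apply/inD_inR/inR_X_diag_act_X/inR_walk.
  apply: inD_diag_actV => //; apply: inD_inR.
  have -> : e = x i 1%g h * act h 1 * x i h 1%g by rewrite rmorph1 mulr1.
  apply: inR_X_diag_act_X.
  exact: inR_diag_act1.
- exact: inD_diag_actD.
- exact: inD_diag_actM.
exact: inD_diag_actV.
Qed.

(** * Short closed walks and entries of [R] *)

Lemma inL_x i h : inL (x i h h).
Proof.
apply: FieldGen; exists h, [:: (1%g, i)]; split=> //=.
  by rewrite big_seq1.
by rewrite mulg1 mulr1.
Qed.

Lemma inL_xx i j h g : inL (x i h g * x j g h).
Proof.
apply: FieldGen; exists h, [:: ((h^-1 * g)%g, i); ((g^-1 * h)%g, j)]; split=> //=.
  by rewrite big_cons big_seq1 /= -mulgA mulKVg mulVg.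
by rewrite mulr1 !mulKVg.
Qed.

Lemma inL_xxx i h g t : inL (x i h g * x i g t * x i t h).
Proof.
apply: FieldGen.
exists h, [:: ((h^-1 * g)%g, i); ((g^-1 * t)%g, i); ((t^-1 * h)%g, i)]; split=> //=.
  by rewrite !big_cons big_nil /= mulg1 -!mulgA !mulKVg mulVg.
by rewrite mulr1 !mulKVg mulrA.
Qed.

(** Entries at [(h, g)] are combinations of walks from [h] to [g], which the edge [x i g h] closes.
    In a product through [t], the two factors are closed separately, by the edges from [t] to [h]
    and from [g] to [t]. *)
Lemma inR_inL i A h g : inR A -> inL (ent A h g * x i g h).
Proof.
have L0 : inL 0.
  by have := FieldConst (ratC G k) (@closed_walk G F k) 0; rewrite rmorph0.
move=> RA; elim: RA h g => [a|_ [t [j ->]]|u v _ IHu _ IHv|u v _ IHu _ IHv] h g.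
- rewrite matCE diag_actE; case: eqP => [->|_]; last by rewrite mul0r.
  by rewrite act_ratC; apply: FieldMul; [apply: FieldConst | apply: inL_x].
- rewrite X_entry; case: eqP => [->|_]; last by rewrite mul0r.
  exact: inL_xx.
- by rewrite mxE mulrDl; apply: FieldAdd; [exact: IHu | exact: IHv].
rewrite -mulmxE ent_mul mulr_suml.
apply: (big_ind inL) => [//|a b|t _]; first exact: FieldAdd.
rewrite (mul_return _ _ _ _ _ _ _ (x_neq0 F i t h) (x_neq0 F i g t) (x_neq0 F i h g)).
apply: FieldMul; first by apply: FieldMul; [exact: IHu | exact: IHv].
by apply: FieldMul; [apply: inL_xx | apply: FieldInv; apply: inL_xxx].
Qed.

Lemma inD_inL r : (0 < k)%N -> inD (diag_act r) -> inL r.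
Proof.
move=> k0; pose i := Ordinal k0.
have RL b : inR (diag_act b) -> inL b.
  (* The loop at [1] is a closed walk, so it can be divided out within [L]. *)
  move=> Rb; rewrite -[b](mulfK (x_neq0 F i 1%g 1%g)).
  apply: FieldMul; last by apply: FieldInv; apply: inL_x.
  by have := inR_inL i _ 1%g 1%g Rb; rewrite diag_actE eqxx Defs.act1.
case/(inD_diag_act _ k0) => b [c [Rb Rc _ _ ->]].
by apply: FieldMul; [apply: RL | apply: FieldInv; apply: RL].
Qed.

(** * The component of degree $e$, the center, and the isomorphisms *)

Lemma inDe_diag_act A : (0 < k)%N ->
  inDe A <-> exists2 r, inL r & A = diag_act r.
Proof.
move=> k0; split=> [[DA A1]|[r Lr ->]]; last first.
  by split; [apply: inL_inD | apply: homogeneous_diag_act].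
have AE : A = diag_act (ent A 1%g 1%g).
  by apply: diag_act_ent => // s h g; apply: inD_act.
by exists (ent A 1%g 1%g) => //; apply: inD_inL; rewrite // -AE.
Qed.

Lemma inZD_diag_act A : (0 < k)%N ->
  inZD A <-> exists2 r, inLG r & A = diag_act r.
Proof.
move=> k0; split=> [[DA AC]|[r [Lr rG] ->]]; last first.
  split; first exact: inL_inD.
  by move=> u _; rewrite diag_act_scalar // -!mulmxE scalar_mxC.
have [c [B [_ _ c0 RB AE]]] := (inDP _ k0).1 DA.
(* Clearing the denominator, [B = c *: A] commutes with [R], which lies in [D]; central in [R], it
   is scalar. *)
have /(center_inR_scalar k0)[b BE] : center_of inR B.
  split=> // u Ru; have BA : B = c *: A by rewrite AE scalerA divff ?scale1r.
  by rewrite BA -!mulmxE -scalemxAl -scalemxAr !mulmxE AC //; apply: inD_inR.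
have {}AE : A = (c^-1 * b)%:M by rewrite AE BE scale_scalar_mx.
have rG : invariant (c^-1 * b).
  move=> s; have := inD_act _ s 1%g 1%g k0 DA.
  by rewrite AE !mxE !eqxx !mulr1n.
have {}AE : A = diag_act (c^-1 * b) by rewrite diag_act_scalar.
by exists (c^-1 * b) => //; split=> //; apply: inD_inL; rewrite // -AE.
Qed.

Lemma diag_act_isomorphic (S : mat -> Prop) (T : K -> Prop) :
  subalgebra (ratC G k) T -> (forall A, S A <-> exists2 r, T r & A = diag_act r) ->
  alg_isomorphic (matC G k) (ratC G k) S T.
Proof.
move=> subT ST; have [TC TD TM] := subT; split=> //.
  split=> [a|A B /ST[r Tr ->] /ST[r' Tr' ->]|A B /ST[r Tr ->] /ST[r' Tr' ->]].
  - by rewrite matCE; apply/ST; exists (ratC G k a).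
  - by rewrite -diag_actD; apply/ST; exists (r + r') => //; apply: TD.
  by rewrite -mulmxE -diag_actM; apply/ST; exists (r * r') => //; apply: TM.
have fE r : ent (diag_act r) 1%g 1%g = r by rewrite diag_actE eqxx Defs.act1.
(* The [(1, 1)] entry inverts [diag_act]. It is additive on all matrices; its multiplicativity rests
   on the diagonal form of elements of [S]. *)
exists (fun A => ent A 1%g 1%g); split=> [a|A B _ _|||r].
- by rewrite matCE fE.
- by rewrite mxE.
- by move=> A B /ST[r _ ->] /ST[r' _ ->]; rewrite -mulmxE -diag_actM !fE.
- by move=> A B /ST[r _ ->] /ST[r' _ ->]; rewrite !fE => ->.
split=> [Tr|[_ /ST[r' Tr' ->] <-]]; last by rewrite fE.
by exists (diag_act r) => //; apply/ST; exists r.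
Qed.

End GenericCrossedProduct.

Theorem theorem2p6 (G : finGroupType) (F : fieldType) (k : nat)
    (charF : [pchar F] =i pred0) (k_gt0 : (0 < k)%N) :
  alg_isomorphic (@matC G F k) (@ratC G F k) (@inDe G F k) (@inL G F k) /\
  alg_isomorphic (@matC G F k) (@ratC G F k) (@inZD G F k) (@inLG G F k).
Proof.
split; apply: diag_act_isomorphic => [|A]; first last.
- exact: inZD_diag_act.
- split=> [a|u v [Lu uG] [Lv vG]|u v [Lu uG] [Lv vG]].
  + by split=> [|s]; [apply: FieldConst | apply: act_ratC].
  + by split=> [|s]; [apply: FieldAdd | rewrite rmorphD /= uG vG].
  by split=> [|s]; [apply: FieldMul | rewrite rmorphM /= uG vG].
- exact: inDe_diag_act.
split=> [a|u v|u v]; [exact: FieldConst | exact: FieldAdd | exact: FieldMul].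
Qed.
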